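(* Let $G$ be a connected graph on $n$ vertices, and let $\mathcal{S}=S_1\cup S_2$ be a partition of $V(G)$ into two non-empty parts which is not an equitable partition of $G$. For each vertex $i$, let $\delta_{i,1}$ and $\delta_{i,2}$ be the numbers of neighbours of $i$ in $S_1$ and in $S_2$, respectively. Suppose there are real scalars $\mu_1,\mu_2,r$ such that $$-\delta_{i,1}+\mu_1\delta_{i,2}=r\ \text{ for all } i\in S_1,\qquad -\delta_{j,2}+\mu_2\delta_{j,1}=r\ \text{ for all } j\in S_2,$$ and suppose that $|\mu_1+\mu_2|<2$ and $\mu_1>\mu_2$. Let $$\alpha=\arctan\left(\frac{\sqrt{4-(\mu_1+\mu_2)^2}}{\mu_1-\mu_2}\right),\qquad \beta=\arccos\left(-\frac{\mu_1+\mu_2}{2}\right)-\alpha+2\pi k$$ for some $k\in\mathbb{N}$. Then for every real scalar $c$, the solution of the frustrated Kuramoto model on $G$ with parameter $\alpha$ and initial conditions $\theta_i(0)=c$ for $i\in S_1$ and $\theta_j(0)=c+\alpha+\beta$ for $j\in S_2$ is $$\theta_i(t)=c+r\sin(\alpha)\,t\quad(i\in S_1),\qquad \theta_j(t)=c+r\sin(\alpha)\,t+\alpha+\beta\quad(j\in S_2).$$ In particular, $\mathcal{S}$ is an $\alpha$-Kuramoto partition of $G$ (with two parts) for this value of $\alpha$.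
   Context: Graphs are finite, without self-loops or multiple edges, with vertex set $V(G)=\{1,\ldots,n\}$ and adjacency matrix $A=A(G)$. Equitable partition: a partition of $V(G)$ into disjoint non-empty parts $S_1,\ldots,S_m$ is equitable if the number of neighbours in $S_j$ of a vertex $v\in S_i$ depends only on the choice of the parts $S_i$ and $S_j$ (for all $i,j$, including $i=j$). Frustrated Kuramoto model (with natural frequency $0$ and interaction strength $1$): for a phase frustration parameter $\alpha$, the system $$\theta_i'(t)=\sum_{j=1}^n A_{i,j}\sin(\theta_j(t)-\theta_i(t)-\alpha),\qquad t\ge 0,\quad i=1,\ldots,n,$$ for real-valued functions $\theta_1,\ldots,\theta_n$ on $[0,\infty)$. $\alpha$-Kuramoto partition: for fixed $\alpha\in(0,\pi/2)$, a partition $\mathcal{S}=S_1\cup\cdots\cup S_m$ of $V(G)$ is an $\alpha$-Kuramoto partition of $G$ if there is an initial condition $\theta_j(0)=x_j$ ($x_j\in\mathbb{R}$, $j=1,\ldots,n$) such that the solution of the frustrated Kuramoto model with this initial condition satisfies: (1) if $i,j\in S_l$ for some $l$, then $\theta_i(t)=\theta_j(t)$ for all $t\ge 0$; (2) if $i\in S_p$, $j\in S_q$ for distinct indices $p,q$, then $\theta_i\neq\theta_j$ as functions on $[0,\infty)$ (i.e. they are not identically equal). *)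

(* Defs.v *)
From HB Require Import structures.
From mathcomp Require Import all_boot all_order all_algebra.
From mathcomp Require Import all_classical all_reals all_analysis.

Set Implicit Arguments.
Unset Strict Implicit.
Unset Printing Implicit Defensive.

Import Order.TTheory GRing.Theory Num.Theory.
Import numFieldNormedType.Exports.

Local Open Scope ring_scope.

(* The vertices 1, ..., n are represented by the elements of 'I_n. *)
Record sgraph (n : nat) := SGraph {
  adj :> rel 'I_n;
  adj_sym : symmetric adj;
  adj_irr : irreflexive adj }.

Definition adjmx (R : realType) (n : nat) (G : sgraph n) : 'M[R]_n :=
  \matrix_(i, j) (G i j)%:R.

Definition connected_graph (n : nat) (G : sgraph n) : Prop :=
  forall i j : 'I_n, fingraph.connect G i j.

Definition nb_neighbours (n : nat) (G : sgraph n) (i : 'I_n) (S : {set 'I_n}) : nat :=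
  #|[set j in S | G i j]%SET|.

(* As for finset.partition, the parts form a set of sets, which excludes
   repeated and empty parts. *)
Definition equitable_partition (n : nat) (G : sgraph n)
    (P : {set {set 'I_n}}) : Prop :=
  finset.partition P [set: 'I_n]%SET /\
  forall A B : {set 'I_n}, A \in P -> B \in P ->
  forall u v : 'I_n, u \in A -> v \in A ->
    nb_neighbours G u B = nb_neighbours G v B.

(* Derivative at t of the restriction of f to [0, +oo[ : two-sided for t > 0,
   right derivative for t = 0. *)
Definition has_derivative_ge0 (R : realType) (f : R -> R) (t l : R) : Prop :=
  ((f s - f t) / (s - t) @[s --> within `[0, +oo[%classic (t^')]
     --> l)%classic.

(* Functions on [0, +oo[ are represented by functions on R of which only the
   values at t >= 0 are used. *)
Definition kuramoto_solution (R : realType) (n : nat) (G : sgraph n)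
    (alpha : R) (theta : 'I_n -> R -> R) : Prop :=
  forall (i : 'I_n) (t : R), 0 <= t ->
    has_derivative_ge0 (theta i) t
      (\sum_(j < n) adjmx R G i j * sin (theta j t - theta i t - alpha)).

Definition kuramoto_ivp (R : realType) (n : nat) (G : sgraph n)
    (alpha : R) (x : 'I_n -> R) (theta : 'I_n -> R -> R) : Prop :=
  kuramoto_solution G alpha theta /\ forall i : 'I_n, theta i 0 = x i.

(* By the Cauchy-Lipschitz theorem, for every x there is exactly one theta (up
   to its values at t < 0) such that kuramoto_ivp G alpha x theta. *)
Definition kuramoto_partition (R : realType) (n : nat) (G : sgraph n)
    (alpha : R) (P : {set {set 'I_n}}) : Prop :=
  [/\ 0 < alpha < pi / 2,
      finset.partition P [set: 'I_n]%SET &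
      exists (x : 'I_n -> R) (theta : 'I_n -> R -> R),
        [/\ kuramoto_ivp G alpha x theta,
            forall A : {set 'I_n}, A \in P ->
              forall i j : 'I_n, i \in A -> j \in A ->
                forall t : R, 0 <= t -> theta i t = theta j t &
            forall A B : {set 'I_n}, A \in P -> B \in P -> A <> B ->
              forall i j : 'I_n, i \in A -> j \in B ->
                ~ (forall t : R, 0 <= t -> theta i t = theta j t)]].

(* Main.v *)
Require Import Defs.
From mathcomp Require Import all_boot all_order all_algebra.
From mathcomp Require Import all_classical all_reals all_analysis.
From mathcomp Require Import ring lra.
Import Order.TTheory GRing.Theory Num.Theory.
Import numFieldNormedType.Exports.
Local Open Scope ring_scope.

(** Write gamma = acos (- (mu1 + mu2) / 2), so that the phase difference
    alpha + beta between the two parts is gamma modulo 2 pi.  If the vertices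
    of each part share one phase and the difference stays gamma, a vertex with
    d1 neighbours in its own part and d2 in the other one moves at the speed
    - d1 sin alpha + d2 sin (gamma - alpha) if it lies in S1, and
    - d1 sin alpha + d2 sin (- gamma - alpha) if it lies in S2.  The values of
    alpha and gamma are chosen so that these two sines are mu1 sin alpha and
    mu2 sin alpha ([kuramoto_angles]); the hypotheses on the degrees then say
    that every vertex moves at the speed r sin alpha, and the difference
    does stay constant.  Hence the announced functions solve the system.

    They are the only solution by the uniqueness half of the Cauchy-Lipschitz
    theorem, which is proved for this system in [kuramoto_solution_unique]:
    the sine is 1-Lipschitz, so the squared Euclidean distance u between two
    solutions satisfies u' <= 4 n u, and a function with u (0) = 0 that
    satisfies such an inequality is nonpositive ([gronwall_le0]).

    The phases of the two parts are distinct functions because gamma > 0 and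
    the added multiple of 2 pi is nonnegative. *)

(** * One-sided derivatives on the half-line *)

Lemma has_derivative_ge0P {R : realType} (f : R -> R) (t l : R) :
  has_derivative_ge0 f t l <->
  forall e, 0 < e -> \forall s \near t,
    s != t -> 0 <= s -> `|l - (f s - f t) / (s - t)| < e.
Proof.
rewrite /has_derivative_ge0; split.
  move=> /cvgrPdist_lt h e e0; have := h e e0.
  rewrite near_withinE near_withinE; apply: filterS => s hs st s0.
  by apply: hs => //=; rewrite in_itv/= s0.
move=> h; apply/cvgrPdist_lt => e e0; have := h e e0.
rewrite near_withinE near_withinE; apply: filterS => s hs st /=.
by rewrite in_itv/= andbT => s0; exact: hs.
Qed.

(** A neighbourhood of a positive t lies in the half-line, so that the
    restriction to the half-line is harmless there. *)
Lemma has_derivative_ge0_is_derive {R : realType} (f : R -> R) (t l : R) :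
  0 < t -> has_derivative_ge0 f t l -> is_derive t 1 f l.
Proof.
move=> t0 /has_derivative_ge0P h.
have cvgf : (h^-1 *: ((f \o shift t) (h *: (1 : R)) - f t) @[h --> 0^'] --> l)%classic.
  apply/cvgrPdist_lt => e /h /nbhs_ballP[d /= d0 hd].
  (* The bound t on the increment keeps the shifted point nonnegative. *)
  have m0 : 0 < Num.min d t by rewrite lt_min d0.
  near=> u; have u0 : u != 0 by near: u; exact: nbhs_dnbhs_neq.
  have : `|u| < Num.min d t by near: u; exact: dnbhs0_lt.
  rewrite lt_min => /andP[ud ut].
  have := hd (u + t); rewrite /ball /= opprD addrCA subrr addr0 normrN => /(_ ud).
  rewrite addrK /= mulrC.
  have -> : (u + t != t) by rewrite -subr_eq0 addrK.
  have -> : 0 <= u + t by move: ut; rewrite ltr_norml => /andP[]; lra.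
  by move=> /(_ isT isT); rewrite /= /GRing.scale /= mulr1.
by split; [apply/cvg_ex; exists l | exact: cvg_lim].
Unshelve. all: by end_near.
Qed.

Lemma has_derivative_ge0_continuous {R : realType} (f g : R -> R) :
  (forall t, 0 <= t -> has_derivative_ge0 f t (g t)) ->
  {within `[0, +oo[%classic, continuous f}%classic.
Proof.
move=> df; apply/subspace_continuousP => t /=; rewrite in_itv/= andbT => t0.
apply/cvgrPdist_lt => e e0; rewrite near_withinE.
(* Near t the difference quotients are bounded by 1 + |g t|. *)
have /has_derivative_ge0P /(_ 1 ltr01) h := df _ t0.
have M0 : 0 < 1 + `|g t| by rewrite ltr_pwDl.
near=> s; rewrite /= in_itv/= andbT => s0.
have [->|st] := eqVneq s t; first by rewrite subrr normr0.
have q : `|g t - (f s - f t) / (s - t)| < 1 by move: st s0; near: s.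
have : `|(f s - f t) / (s - t)| < 1 + `|g t|.
  by rewrite -ltrBlDr (le_lt_trans (lerB_dist _ _)) // distrC.
have std : 0 < `|s - t| by rewrite normr_gt0 subr_eq0.
rewrite normrM normfV ltr_pdivrMr // distrC => /lt_le_trans; apply.
rewrite mulrC -ler_pdivlMr // distrC ltW //.
by near: s; apply: cvgr_dist_lt => //; rewrite divr_gt0.
Unshelve. all: by end_near.
Qed.

(** * Uniqueness of solutions *)

Lemma sin_lipschitz {R : realType} (x y : R) : `|sin x - sin y| <= `|x - y|.
Proof.
wlog xy : x y / y <= x.
  by move=> h; case: (leP y x) => [/h//|/ltW/h]; rewrite distrC [leRHS]distrC.
have [|c _ ->] := @MVT_segment R sin cos y x xy (fun z _ => is_derive_sin z).
  by apply: continuous_subspaceT => z; exact: continuous_sin.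
by rewrite normrM ler_piMl // ler_norml cos_geN1 cos_le1.
Qed.

(** The function u (t) exp (- L t) is nonincreasing. *)
Lemma gronwall_le0 {R : realType} (u du : R -> R) (L : R) :
  {within `[0, +oo[%classic, continuous u}%classic ->
  (forall t : R, 0 < t -> is_derive t 1 u (du t)) ->
  (forall t : R, 0 < t -> du t <= L * u t) ->
  u 0 <= 0 -> forall t : R, 0 <= t -> u t <= 0.
Proof.
move=> cu dU duL u0 t t0.
pose v := (u * (expR \o ( *%R (- L))))%R.
have dv (s : R) : 0 < s -> is_derive s 1 v ((du s - L * u s) * expR (- L * s)).
  move=> s0; have dus := dU _ s0.
  have dm : is_derive s (1:R) ( *%R (- L)) (- L).
    have := is_deriveZ (- L) (is_derive_id (s : R) (1 : R)).
    by rewrite /GRing.scale/= mulr1.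
  have dE : is_derive s 1 (expR \o ( *%R (- L))) (expR (- L * s) * - L).
    exact: is_derive1_comp.
  apply: is_derive_eq; rewrite /= /GRing.scale /=; ring.
have vt : v t <= v 0.
  apply: (@ler0_derive1_nincry _ v 0) => //.
  - by move=> s; rewrite in_itv/= andbT => /dv[].
  - move=> s; rewrite in_itv/= andbT => s0; have dvs := dv _ s0.
    rewrite derive1E derive_val.
    by rewrite pmulr_lle0 ?expR_gt0// subr_le0 duL.
  - move=> x; apply: continuousM; first exact: cu.
    apply: continuous_subspaceT => y; apply: continuous_comp.
      exact: mulrl_continuous.
    exact: continuous_expR.
have vE s : v s = u s * expR (- L * s) by [].
have : v t <= 0 by apply: (le_trans vt); rewrite vE mulr0 expR0 mulr1.
by rewrite vE pmulr_lle0 ?expR_gt0.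
Qed.

(** Gronwall's inequality is applied to the sum of the squares of the
    differences w_i of the phases. *)
Lemma kuramoto_solution_unique {R : realType} {n : nat} {G : sgraph n}
    {alpha : R} {theta phi : 'I_n -> R -> R} :
  kuramoto_solution G alpha theta -> kuramoto_solution G alpha phi ->
  (forall i, theta i 0 = phi i 0) ->
  forall i (t : R), 0 <= t -> theta i t = phi i t.
Proof.
move=> stheta sphi eq0.
pose w i := theta i - phi i.
pose F (th : 'I_n -> R -> R) i t :=
  \sum_(j < n) adjmx R G i j * sin (th j t - th i t - alpha).
pose u := \sum_(i < n) w i ^+ 2.
pose du t := \sum_(i < n) 2 * w i t * (F theta i t - F phi i t).
have uE t : u t = \sum_(i < n) w i t ^+ 2.
  by rewrite /u fct_sumE; apply: eq_bigr => i _; rewrite fctE.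
have cw i : {within `[0, +oo[%classic, continuous (w i)}%classic.
  apply: within_continuousB.
    exact: has_derivative_ge0_continuous (stheta i).
  exact: has_derivative_ge0_continuous (sphi i).
have dw i (t : R) : 0 < t -> is_derive t 1 (w i) (F theta i t - F phi i t).
  move=> t0; apply: is_deriveB; apply: has_derivative_ge0_is_derive => //.
    exact: stheta (ltW t0).
  exact: sphi (ltW t0).
have u_le0 : forall t : R, 0 <= t -> u t <= 0.
  apply: (@gronwall_le0 _ u du (4 * n%:R)).
  - rewrite /u; apply: (big_ind (fun f : R -> R =>
      {within `[0, +oo[%classic, continuous f}%classic)) => [x|f g|i _].
    + exact: cvg_cst.
    + by move=> cf cg; exact: (within_continuousD cf cg).
    + by rewrite expr2 => x; apply: cvgM; exact: cw.
  - move=> t t0; apply: is_derive_sum => i; have dwi := dw i _ t0.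
    by apply: is_derive_eq; rewrite /GRing.scale /= expr1.
  - move=> t t0.
    (* Each pair (i, j) contributes at most
       2 |w_i| (|w_j| + |w_i|) <= 3 w_i^2 + w_j^2, whence the constant 4 n. *)
    have step i : 2 * w i t * (F theta i t - F phi i t) <=
        \sum_(j < n) (3 * w i t ^+ 2 + w j t ^+ 2).
      rewrite /F -sumrB mulr_sumr; apply: ler_sum => j _.
      rewrite -mulrBr mxE.
      set a := sin _; set b := sin _.
      have lip : `|a - b| <= `|w j t| + `|w i t|.
        apply: (le_trans (sin_lipschitz _ _)).
        rewrite (_ : _ - _ = w j t - w i t); first exact: ler_normB.
        by rewrite /w !fctE; ring.
      apply: (@le_trans _ _ (2 * `|w i t| * (`|w j t| + `|w i t|))).
        apply: (le_trans (ler_norm _)); rewrite !normrM normr_nat.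
        rewrite ler_wpM2l ?mulr_ge0 //.
        by apply: le_trans lip; case: (G i j);
          rewrite ?normr1 ?mul1r// normr0 mul0r.
      rewrite -(real_normK (num_real (w i t))) -(real_normK (num_real (w j t))).
      rewrite -subr_ge0; apply: (le_trans (sqr_ge0 (`|w i t| - `|w j t|))).
      by rewrite le_eqVlt; apply/orP; left; apply/eqP; ring.
    apply: (le_trans (ler_sum _ (fun i _ => step i))).
    under eq_bigr do rewrite big_split/= sumr_const card_ord -uE.
    rewrite big_split/= sumr_const card_ord sumrMnl.
    rewrite -mulr_sumr -uE -[X in X + _ <= _]mulr_natl.
    rewrite -[X in _ + X <= _]mulr_natl.
    by rewrite le_eqVlt; apply/orP; left; apply/eqP; ring.
  - by rewrite uE big1 // => i _; rewrite /w fctE eq0 subrr expr0n.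
move=> i t t0; have := u_le0 _ t0; rewrite uE => S0.
have sge0 (j : 'I_n) : true -> 0 <= w j t ^+ 2 by rewrite sqr_ge0.
have /eqP : \sum_(j < n) w j t ^+ 2 = 0.
  by apply/eqP; rewrite eq_le S0 sumr_ge0.
rewrite psumr_eq0 // => /allP /(_ i (mem_index_enum i)) /=.
by rewrite sqrf_eq0 subr_eq0 => /eqP.
Qed.

Lemma has_derivative_ge0_affine {R : realType} (f : R -> R) (a b t : R) :
  (forall s : R, 0 <= s -> f s = a + b * s) -> 0 <= t -> has_derivative_ge0 f t b.
Proof.
move=> fE t0; apply/has_derivative_ge0P => e e0.
near=> s => st s0; rewrite !fE //.
rewrite (_ : a + b * s - (a + b * t) = b * (s - t)); last by ring.
by rewrite mulfK ?subr_eq0// subrr normr0.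
Unshelve. all: by end_near.
Qed.

(** * The two-cluster solution *)

(** The number alpha is the angle with s cos alpha = (mu1 - mu2) sin alpha,
    where s = sqrt (4 - (mu1 + mu2)^2), whereas cos gamma = - (mu1 + mu2) / 2
    and sin gamma = s / 2; the last two equalities follow by the addition
    formulas. *)
Lemma kuramoto_angles {R : realType} {mu1 mu2 : R} :
  `|mu1 + mu2| < 2 -> mu2 < mu1 ->
  let alpha := atan (Num.sqrt (4 - (mu1 + mu2) ^+ 2) / (mu1 - mu2)) in
  let gamma := acos (- ((mu1 + mu2) / 2)) in
  [/\ 0 < alpha < pi / 2, 0 < gamma,
      sin (gamma - alpha) = mu1 * sin alpha &
      sin (- gamma - alpha) = mu2 * sin alpha].
Proof.
rewrite ltr_norml => /andP[lo hi] mu12 alpha gamma.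
set m := - ((mu1 + mu2) / 2) in gamma *.
set s := Num.sqrt _ in alpha *.
have s_gt0 : 0 < s by rewrite sqrtr_gt0; nra.
have mB : -1 <= m <= 1 by rewrite /m; lra.
have d_gt0 : 0 < mu1 - mu2 by rewrite subr_gt0.
have tan_alpha : tan alpha = s / (mu1 - mu2) by rewrite atanK.
have alpha_lt : alpha < pi / 2 by exact: atan_ltpi2.
have alpha_gt0 : 0 < alpha.
  by rewrite /alpha -(@atan0 R) lt_atan// divr_gt0.
have cos_alpha : 0 < cos alpha.
  apply: cos_gt0_pihalf; rewrite alpha_lt andbT (lt_trans _ alpha_gt0)//.
  by rewrite oppr_lt0 divr_gt0// pi_gt0.
have cos_sin_alpha : s * cos alpha = (mu1 - mu2) * sin alpha.
  move: tan_alpha => /eqP; rewrite /tan eqr_div ?lt0r_neq0// => /eqP.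
  by move=> /esym ->; rewrite mulrC.
have cosg : cos gamma = m by rewrite acosK// in_itv.
have sing : sin gamma = s / 2.
  rewrite sin_acos//.
  rewrite (_ : 1 - m ^+ 2 = (4 - (mu1 + mu2) ^+ 2) * (2^-1) ^+ 2); last first.
    by rewrite /m; field.
  rewrite sqrtrM; last by nra.
  by rewrite sqrtr_sqr ger0_norm.
have gt0g : 0 < gamma by apply: acos_gt0; rewrite /m; lra.
split=> //; first by rewrite alpha_gt0.
- by rewrite sinB sing cosg mulrAC cos_sin_alpha /m; field.
- by rewrite sinB sinN cosN sing cosg mulNr mulrAC cos_sin_alpha /m; field.
Qed.

Lemma sin_shift2pi {R : realType} (x : R) (k : nat) :
  sin (x + 2 * pi * k%:R) = sin x.
Proof.
by rewrite mulr_natr mulr_natl; exact: (periodicn (@sinD2pi R)).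
Qed.

Lemma sum_adj_two_values {R : realType} {n : nat} (G : sgraph n)
    {S1 S2 : {set 'I_n}} (i : 'I_n) {f : 'I_n -> R} {a b : R} :
  (forall j, (j \in S2) = (j \notin S1)) ->
  (forall j, j \in S1 -> f j = a) -> (forall j, j \in S2 -> f j = b) ->
  \sum_(j < n) adjmx R G i j * f j =
    (nb_neighbours G i S1)%:R * a + (nb_neighbours G i S2)%:R * b.
Proof.
move=> S12 fa fb.
have nbE (S : {set 'I_n}) (c : R) :
    (nb_neighbours G i S)%:R * c = \sum_(j < n | j \in S) adjmx R G i j * c.
  rewrite /nb_neighbours -sum1dep_card natr_sum mulr_suml big_mkcondr/=.
  by apply: eq_bigr => j _; rewrite mxE; case: (G i j); rewrite // mul0r.
rewrite !nbE (bigID (mem S1))/=; congr (_ + _).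
  by apply: eq_bigr => j jS; rewrite fa.
rewrite (eq_bigl (mem S2)) => [|j]; last by rewrite -S12.
by apply: eq_bigr => j jS; rewrite fb.
Qed.

Lemma partition2_compl {T : finType} {S1 S2 : {set T}} :
  finset.partition [set S1; S2]%SET [set: T]%SET -> S1 <> S2 ->
  forall j, (j \in S2) = (j \notin S1).
Proof.
move=> /and3P[/eqP cov /finset.trivIsetP triv _] /eqP S12 j.
have /pred0P/(_ j) /= := triv S1 S2 (set21 _ _) (set22 _ _) S12.
have : j \in finset.cover [set S1; S2]%SET by rewrite cov finset.in_setT.
by move=> /finset.bigcupP[B /set2P[] -> ->] /=; [move=> -> | rewrite andbT => ->].
Qed.

Theorem mainTheorem3 (R : realType) (n : nat) (G : sgraph n)
    (S1 S2 : {set 'I_n}) (mu1 mu2 r : R) (k : nat) :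
  connected_graph G ->
  finset.partition [set S1; S2]%SET [set: 'I_n]%SET ->
  S1 <> S2 ->
  ~ equitable_partition G [set S1; S2]%SET ->
  (forall i : 'I_n, i \in S1 ->
     - (nb_neighbours G i S1)%:R + mu1 * (nb_neighbours G i S2)%:R = r) ->
  (forall j : 'I_n, j \in S2 ->
     - (nb_neighbours G j S2)%:R + mu2 * (nb_neighbours G j S1)%:R = r) ->
  `|mu1 + mu2| < 2 ->
  mu1 > mu2 ->
  let alpha := atan (Num.sqrt (4 - (mu1 + mu2) ^+ 2) / (mu1 - mu2)) in
  let beta := acos (- ((mu1 + mu2) / 2)) - alpha + 2 * pi * k%:R in
  (forall (c : R) (x : 'I_n -> R),
     (forall i : 'I_n, i \in S1 -> x i = c) ->
     (forall j : 'I_n, j \in S2 -> x j = c + alpha + beta) ->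
     forall theta : 'I_n -> R -> R,
       kuramoto_ivp G alpha x theta <->
       forall t : R, 0 <= t ->
         (forall i : 'I_n, i \in S1 -> theta i t = c + r * sin alpha * t) /\
         (forall j : 'I_n, j \in S2 ->
            theta j t = c + r * sin alpha * t + alpha + beta)) /\
  kuramoto_partition G alpha [set S1; S2]%SET.
Proof.
move=> _ partS S12 _ bal1 bal2 mu_lt2 mu12 alpha.
set gamma := acos _ => beta.
have [alphaB gamma_gt0 sin1 sin2] := kuramoto_angles mu_lt2 mu12.
rewrite -/alpha -/gamma in alphaB gamma_gt0 sin1 sin2.
have compl := partition2_compl partS S12.
pose solves c (theta : 'I_n -> R -> R) := forall t : R, 0 <= t ->
  (forall i : 'I_n, i \in S1 -> theta i t = c + r * sin alpha * t) /\
  (forall j : 'I_n, j \in S2 ->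
     theta j t = c + r * sin alpha * t + alpha + beta).
have shift_gt0 : 0 < alpha + beta.
  rewrite /beta addrC -addrA [_ + alpha]addrC addrA subrK.
  by rewrite ltr_pwDl// mulr_ge0// mulr_ge0// pi_ge0.
have solution c theta : solves c theta -> kuramoto_solution G alpha theta.
  move=> sol i t t0; have [th1 th2] := sol t t0.
  have [iS1|] := boolP (i \in S1).
    rewrite (sum_adj_two_values (a := - sin alpha) (b := mu1 * sin alpha)
      G i compl).
    - rewrite (_ : _ + _ = r * sin alpha); last by rewrite -(bal1 i)//; ring.
      apply: (@has_derivative_ge0_affine _ _ c) => // s s0.
      by have [/(_ i iS1)] := sol s s0.
    - by move=> j jS1; rewrite !th1// subrr sub0r sinN.
    - move=> j jS2; rewrite (th2 _ jS2) (th1 _ iS1) -sin1 -[RHS](sin_shift2pi _ k).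
      by congr sin; rewrite /beta; ring.
  rewrite -compl => iS2.
  rewrite (sum_adj_two_values (a := mu2 * sin alpha) (b := - sin alpha)
    G i compl).
  - rewrite (_ : _ + _ = r * sin alpha); last by rewrite -(bal2 i)//; ring.
    apply: (@has_derivative_ge0_affine _ _ (c + alpha + beta)) => // s s0.
    by have [_ /(_ i iS2) ->] := sol s s0; ring.
  - move=> j jS1; rewrite (th1 _ jS1) (th2 _ iS2) -sin2 -[LHS](sin_shift2pi _ k).
    by congr sin; rewrite /beta; ring.
  - by move=> j jS2; rewrite !th2// subrr sub0r sinN.
pose phi c (i : 'I_n) (t : R) :=
  c + r * sin alpha * t + (if i \in S1 then 0 else alpha + beta).
have phi_solves c : solves c (phi c).
  move=> t _; split=> i; rewrite /phi; first by move=> ->; rewrite addr0.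
  by rewrite compl => /negbTE ->; rewrite !addrA.
split.
  move=> c x x1 x2 theta; split.
    move=> [sth th0] t t0.
    have thE i : theta i t = phi c i t.
      apply: (kuramoto_solution_unique sth (solution c _ (phi_solves c))) => // j.
      have [ph1 ph2] := phi_solves c 0 (lexx _).
      have [jS1|] := boolP (j \in S1).
        by rewrite th0 x1// ph1// mulr0 addr0.
      by rewrite -compl => jS2; rewrite th0 x2// ph2// mulr0 addr0.
    have [ph1 ph2] := phi_solves c t t0.
    by split=> i iS; rewrite thE; [exact: ph1 | exact: ph2].
  move=> sol; split; first exact: (solution c).
  move=> i; have [th1 th2] := sol 0 (lexx _).
  have [iS1|] := boolP (i \in S1); first by rewrite th1// x1// mulr0 addr0.
  by rewrite -compl => iS2; rewrite th2// x2// mulr0 addr0.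
split=> //; exists (fun i => phi 0 i 0), (phi 0); split.
- by split=> //; exact: (solution 0).
- by move=> A /set2P[] -> i j; rewrite /phi ?compl => iA jA t _;
    rewrite ?iA ?jA ?(negbTE iA) ?(negbTE jA).
- have sep i j : i \in S1 -> j \in S2 -> phi 0 i 0 <> phi 0 j 0.
    rewrite compl /phi => -> /negbTE -> /addrI /esym /eqP.
    by rewrite (gt_eqF shift_gt0).
  move=> A B /set2P[] -> /set2P[] -> // _ i j iA jB /(_ 0 (lexx _)).
    exact: sep.
  by move/esym; exact: sep.
Qed.
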